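(* Consider the coordinated system with perfectly observed mean-field described in the context. There is no loss of optimality in restricting attention to Markovian coordination strategies, i.e. strategies of the form $\Gamma_t=\psi_t(Z_t)$, $t=1,\dots,T$: the infimum of $\hat J(\boldsymbol\psi)$ over all coordination strategies $\Gamma_t=\psi_t(Z_{1:t})$ equals its infimum over Markovian ones. Furthermore, an optimal strategy is obtained by solving the following dynamic program. Define $V_{T+1}(z):=0$ for all $z\in\mathcal M_n$ and, recursively for $t=T,\dots,1$ and $z_t\in\mathcal M_n$, $$V_t(z_t):=\min_{\gamma_t}\Big(\hat\ell_t(z_t,\gamma_t)+\mathbb E[V_{t+1}(Z_{t+1})\mid Z_t=z_t,\Gamma_t=\gamma_t]\Big),$$ where the minimum is over all functions $\gamma_t:\mathcal X\to\mathcal U$. Let $\psi_t^*(z_t)$ denote any minimizer of the right-hand side. Then the coordination strategy $\boldsymbol\psi^*=(\psi_1^*,\dots,\psi_T^* )$, used as $\Gamma_t=\psi^*_t(Z_t)$, is optimal: $\hat J(\boldsymbol\psi^* )\le\hat J(\boldsymbol\psi)$ for every coordination strategy $\boldsymbol\psi$.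
   Context: Model. $n,T\in\mathbb N$; $\mathcal X$ (states) and $\mathcal U$ (actions) are finite sets. Subsystem $i\in\{1,\dots,n\}$ has state $X^i_t\in\mathcal X$ and action $U^i_t\in\mathcal U$ at time $t$; $\mathbf X_t=(X^1_t,\dots,X^n_t)$, $\mathbf U_t=(U^1_t,\dots,U^n_t)$. The mean-field is $Z_t=\frac1n\sum_{i=1}^n\delta_{X^i_t}$, i.e. $Z_t(x)=\frac1n\sum_{i}\mathbb 1(X^i_t=x)$, taking values in the set $\mathcal M_n$ of probability distributions on $\mathcal X$ whose values all lie in $\{0,\frac1n,\dots,\frac nn\}$. Dynamics: $X^i_{t+1}=f_t(X^i_t,U^i_t,W^i_t,Z_t)$ for $t=1,\dots,T$, with given functions $f_t$ not depending on $i$. The initial states $X^i_1$ have common PMF $P_X$, the noises $W^i_t$ are discrete with PMF $P_{W_t}$ (not depending on $i$), and all of $X^1_1,\dots,X^n_1$, $W^i_t$ ($1\le i\le n$, $1\le t\le T$) are mutually independent. Costs: arbitrary functions $\ell_t:\mathcal X^n\times\mathcal U^n\to\mathbb R$. Coordinated system. A coordinator observes $Z_{1:t}=(Z_1,\dots,Z_t)$ and chooses a map $\Gamma_t:\mathcal X\to\mathcal U$ by $\Gamma_t=\psi_t(Z_{1:t})$; then $U^i_t=\Gamma_t(X^i_t)$ for all $i$. The collection $\boldsymbol\psi=(\psi_1,\dots,\psi_T)$ is a coordination strategy. Write $\ell_t(\mathbf x,\gamma):=\ell_t(\mathbf x,(\gamma(x^1),\dots,\gamma(x^n)))$ and $\hat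 J(\boldsymbol\psi)=\mathbb E^{\boldsymbol\psi}[\sum_{t=1}^T\ell_t(\mathbf X_t,\Gamma_t)]$, the expectation being under the law induced by $\boldsymbol\psi$. Optimal means minimizing $\hat J$ over all coordination strategies. Notation in the dynamic program. For $z\in\mathcal M_n$ let $H(z)=\{\mathbf x\in\mathcal X^n:\frac1n\sum_i\delta_{x^i}=z\}$. Then $\hat\ell_t(z,\gamma):=\frac1{|H(z)|}\sum_{\mathbf x\in H(z)}\ell_t(\mathbf x,\gamma)$, which is the strategy-independent function satisfying $\mathbb E[\ell_t(\mathbf X_t,\Gamma_t)\mid Z_{1:t},\Gamma_{1:t}]=\hat\ell_t(Z_t,\Gamma_t)$. The conditional law of $Z_{t+1}$ given $Z_t=z,\Gamma_t=\gamma$ (strategy-independent) is the law of $\frac1n\sum_i\delta_{f_t(x^i,\gamma(x^i),W^i_t,z)}$ with $\mathbf x$ uniform on $H(z)$ and independent of $(W^1_t,\dots,W^n_t)$; this defines the conditional expectation for all $(z,\gamma)$, including pairs of probability zero. *)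

(* Defs.v *)
From HB Require Import structures.
From mathcomp Require Import all_boot all_order all_algebra.
From mathcomp Require Import all_classical all_reals all_analysis.

Set Implicit Arguments.
Unset Strict Implicit.
Unset Printing Implicit Defensive.
Import Order.TTheory GRing.Theory Num.Theory.
Local Open Scope classical_set_scope.
Local Open Scope ring_scope.

(* Times are counted from 0: stage [t < T] stands for the
   (t+1)-st of the stages 1, ..., T.  Stage-indexed data are families over
   [nat], of which only the members of index [t < T] are ever relevant. *)

Section MeanField.
Variables (R : realType) (n : nat) (X : finType).

Definition is_mean_field (z : {ffun X -> R}) : bool :=
  [forall x, [exists k : 'I_n.+1, z x == k%:R / n%:R]] && (\sum_x z x == 1).

Definition mean_field := {z : {ffun X -> R} | is_mean_field z}.

Definition empirical (x : {ffun 'I_n -> X}) : {ffun X -> R} :=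
  [ffun a => n%:R^-1 * \sum_(i < n) (x i == a)%:R].

Hypothesis n_gt0 : (0 < n)%N.

Lemma empirical_is_mean_field x : is_mean_field (empirical x).
Proof.
apply/andP; split.
  apply/forallP => a; apply/existsP.
  have lt_card : (#|[set i | x i == a]%SET| < n.+1)%N.
    by rewrite ltnS -[leqRHS]card_ord max_card.
  have card_sum : (\sum_(i < n) (x i == a) = #|[set i | x i == a]%SET|)%N.
    by rewrite -sum1_card [RHS]big_mkcond; apply: eq_bigr => i _; rewrite inE; case: eqP.
  by exists (Ordinal lt_card); rewrite ffunE mulrC -natr_sum card_sum.
under eq_bigr do rewrite ffunE.
rewrite -mulr_sumr exchange_big /=.
rewrite (eq_bigr (fun=> 1)) => [|i _]; last first.
  rewrite (bigD1 (x i)) //= eqxx big1 ?addr0 // => a /negPf.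
  by rewrite eq_sym => ->.
by rewrite sumr_const card_ord mulVf // pnatr_eq0 -lt0n.
Qed.

Definition mean_field_of (x : {ffun 'I_n -> X}) : mean_field :=
  exist _ (empirical x) (empirical_is_mean_field x).

(* The state vectors with mean-field [z], written H(z) below. *)
Definition configs (z : mean_field) : {set {ffun 'I_n -> X}} :=
  [set x | mean_field_of x == z]%SET.

End MeanField.

Section DiscreteVariables.
Context {d : measure_display} {Omega : measurableType d} {R : realType}.
Variable P : probability Omega R.

(* [Y] is measurable for the discrete sigma-algebra on [E] and has PMF [p]. *)
Definition has_pmf (E : countType) (Y : Omega -> E) (p : E -> R) : Prop :=
  (forall A : set E, measurable (Y @^-1` A)) /\
  (forall a : E, P (Y @^-1` [set a]) = (p a)%:E).

(* Each [E i] carries the discrete sigma-algebra. *)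
Definition mutually_independent (I : finType) (E : I -> Type)
    (Y : forall i, Omega -> E i) : Prop :=
  forall (J : {set I}) (A : forall i, set (E i)),
    P [set w | forall i, i \in J -> A i (Y i w)] =
    (\prod_(i in J) P (Y i @^-1` A i))%E.

End DiscreteVariables.

(* The initial states and the noises of the stages [t < T], as one family. *)
Section Primitives.
Variables (n T : nat) (X : finType) (W : nat -> countType) (Omega : Type).
Variables (X1 : 'I_n -> Omega -> X) (N : forall t, 'I_n -> Omega -> W t).

Definition primitive_index : finType := ('I_n + 'I_T * 'I_n)%type.

Definition primitive_type (j : primitive_index) : Type :=
  match j with inl _ => X | inr (t, _) => W t end.

Definition primitive (j : primitive_index) : Omega -> primitive_type j :=
  match j with inl i => X1 i | inr (t, i) => N t i end.

End Primitives.

Section CoordinatedSystem.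
Variables (R : realType) (n : nat) (n_gt0 : (0 < n)%N) (T : nat).
Variables (X U : finType) (W : nat -> countType).

Local Notation M := (mean_field R n X).
Local Notation mf := (mean_field_of R n_gt0).
Local Notation prescription := {ffun X -> U}.

Variable f : forall t, X -> U -> W t -> M -> X.
Variable ell : nat -> {ffun 'I_n -> X} -> {ffun 'I_n -> U} -> R.

Definition apply_prescription (g : prescription) (x : {ffun 'I_n -> X}) :
    {ffun 'I_n -> U} := [ffun i => g (x i)].

Definition next_state t (x : {ffun 'I_n -> X}) (g : prescription)
    (w : 'I_n -> W t) (z : M) : {ffun 'I_n -> X} :=
  [ffun i => f (x i) (g (x i)) (w i) z].

(* At stage [t] the history (Z_0, ..., Z_t) has [t.+1] entries. *)
Definition strategy : Type := forall t : nat, t.+1.-tuple M -> prescription.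

Definition markov_strategy : Type := nat -> M -> prescription.

Definition of_markov (g : markov_strategy) : strategy :=
  fun t h => g t (tnth h ord_max).

Context {d : measure_display} {Omega : measurableType d}.
Variable P : probability Omega R.
Variables (X1 : 'I_n -> Omega -> X) (N : forall t, 'I_n -> Omega -> W t).

(* The mean-field history (Z_0, ..., Z_t) and the state vector X_t under [psi]. *)
Fixpoint run (psi : strategy) (w : Omega) (t : nat) :
    t.+1.-tuple M * {ffun 'I_n -> X} :=
  match t with
  | 0 => let x := [ffun i => X1 i w] in ([tuple mf x], x)
  | s.+1 =>
    let: (h, x) := run psi w s in
    let x' := next_state x (psi s h) (fun i => N s i w) (mf x) in
    ([tuple of rcons h (mf x')], x')
  end.

Definition stage_cost (psi : strategy) (t : nat) (w : Omega) : R :=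
  let: (h, x) := run psi w t in ell t x (apply_prescription (psi t h) x).

Definition total_cost (psi : strategy) : \bar R :=
  ('E_P[fun w => (\sum_(t < T) stage_cost psi t w)%R])%E.

Definition cost_hat (t : nat) (z : M) (g : prescription) : R :=
  #|configs n_gt0 z|%:R^-1 *
  \sum_(x in configs n_gt0 z) ell t x (apply_prescription g x).

(* E[v(Z_{t+1}) | Z_t = z, Gamma_t = g]: the state vector is averaged uniformly
   over H(z), independently of the stage-[t] noises, whose expectation is taken
   on [Omega].  The integrand has finite range, so [fine] discards nothing. *)
Definition cond_exp_next (t : nat) (v : M -> R) (z : M) (g : prescription) : R :=
  #|configs n_gt0 z|%:R^-1 *
  \sum_(x in configs n_gt0 z)
    fine ('E_P[fun w => v (mf (next_state x g (fun i => N t i w) z))])%E.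

Definition dp_rhs (t : nat) (v : M -> R) (z : M) (g : prescription) : R :=
  cost_hat t z g + cond_exp_next t v z g.

(* [u0] witnesses that there is an action; being the value at one of the
   prescriptions, the default of the iterated [Num.min] does not affect it. *)
Variable u0 : U.

Definition dp_min (t : nat) (v : M -> R) (z : M) : R :=
  \big[Num.min/dp_rhs t v z [ffun=> u0]]_(g : prescription) dp_rhs t v z g.

(* The value function with [k] stages to go, i.e. at stage [T - k]. *)
Fixpoint value_to_go (k : nat) : M -> R :=
  match k with
  | 0 => fun=> 0
  | k'.+1 => dp_min (T - k'.+1) (value_to_go k')
  end.

Definition value (t : nat) : M -> R := value_to_go (T - t).

Lemma value_end z : value T z = 0.
Proof. by rewrite /value subnn. Qed.

Lemma value_step t z : (t < T)%N -> value t z = dp_min t (value t.+1) z.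
Proof. by move=> ltT; rewrite /value -(subnSK ltT) /= subnSK // subKn // ltnW. Qed.

Definition dp_minimizer (g : markov_strategy) : Prop :=
  forall t, (t < T)%N -> forall (z : M) (gamma : prescription),
    dp_rhs t (value t.+1) z (g t z) <= dp_rhs t (value t.+1) z gamma.

End CoordinatedSystem.

(* Main.v *)
Require Import Defs.
From HB Require Import structures.
From mathcomp Require Import all_boot all_order all_algebra all_fingroup.
From mathcomp Require Import all_classical all_reals all_analysis.

Set Implicit Arguments.
Unset Strict Implicit.
Unset Printing Implicit Defensive.
Import Order.TTheory GRing.Theory Num.Theory.
Local Open Scope classical_set_scope.
Local Open Scope ring_scope.

(** The crux is exchangeability.  Initial states and noises are i.i.d. over the
subsystems, the dynamics treat all subsystems alike, and a coordinator who sees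
only mean-fields cannot tell two relabelings of a state vector apart.  Hence,
given the history Z_0, ..., Z_t, the state vector is uniform on the set H(Z_t)
of vectors with mean-field Z_t, whatever the strategy: H(z) is one orbit of
the symmetric group.  Averaging over this orbit turns the expected stage cost
and the expected continuation value into the right-hand side of the dynamic
program, evaluated at Z_t and at the prescription in use.

The law of (Z_0, ..., Z_t; X_t) is handled as a positive linear functional
[path_exp] on functions of history and state, defined by recursion on time from
an initial law and a transition kernel; in this form no summation over
histories occurs.  Exchangeability is [path_exp_relabel], and
[path_exp_average] is its consequence.  Then telescoping any function V that
vanishes at the horizon along the path gives [sum_stage_exp]: the total cost is
the mean of V at time 0 plus the expected sum over time of the advantages
(the Bellman right-hand side at the prescription in use, minus V).  With V the
value function every advantage is nonnegative, which bounds the cost of every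
strategy from below by the mean of V at time 0; along a strategy made of
minimizers every advantage is zero, so this bound is attained.

That [path_exp] computes expectations on the probability space is
[integral_run].  A step of the run depends on the past only through finitely
many events, and each of these splits into an event of the past and a
rectangle in the noises of the current stage.  The induction therefore carries
along an arbitrary rectangle in the present and future noises, and the product
formula for rectangles is all that is used of independence. *)

(** * State vectors up to relabeling of the subsystems *)

Section Permutations.
Variables (R : realType) (n : nat) (n_gt0 : (0 < n)%N) (X : finType).
Local Notation state := {ffun 'I_n -> X}.
Local Notation mf := (mean_field_of R n_gt0).

Definition relabel (s : 'S_n) (x : state) : state := [ffun i => x (s i)].

Lemma relabelK s : cancel (relabel s) (relabel s^-1%g).
Proof. by move=> x; apply/ffunP => i; rewrite !ffunE permKV. Qed.

Lemma relabelVK s : cancel (relabel s^-1%g) (relabel s).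
Proof. by move=> x; apply/ffunP => i; rewrite !ffunE permK. Qed.

Lemma relabel_bij s : bijective (relabel s).
Proof. by exists (relabel s^-1%g); [apply: relabelK|apply: relabelVK]. Qed.

Lemma relabelM s u x : relabel s (relabel u x) = relabel (s * u)%g x.
Proof. by apply/ffunP => i; rewrite !ffunE permM. Qed.

Lemma mf_relabel s x : mf (relabel s x) = mf x.
Proof.
apply: val_inj; apply/ffunP => a; rewrite !ffunE; congr (_ * _).
rewrite [RHS](reindex_inj (@perm_inj _ s)).
by apply: eq_bigr => i _; rewrite ffunE.
Qed.

(** A mean-field lists the multiplicities of the states, and two words with the
    same multiplicities are permutations of each other. *)
Lemma mf_eq_relabel x y : mf x = mf y -> exists s, y = relabel s x.
Proof.
move=> /(congr1 val) /= exy.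
have cnt (z : state) a : \sum_(i < n) (z i == a)%:R =
    (count_mem a [tuple z i | i < n])%:R :> R.
  rewrite /= /image_mem count_map -sum1_count big_enum_cond/= -natr_sum.
  by rewrite [in RHS]big_mkcond; congr (_%:R); apply: eq_bigr => i _; case: eqP.
have : perm_eq [tuple y i | i < n] [tuple x i | i < n].
  apply/allP => a _ /=; apply/eqP.
  apply/eqP; rewrite -(eqr_nat R); apply/eqP; move/ffunP: exy => /(_ a).
  rewrite !ffunE => /mulfI; rewrite !cnt => -> //.
  by rewrite invr_eq0 pnatr_eq0 -lt0n.
move=> /tuple_permP [s es]; exists s; apply/ffunP => i.
have /val_inj e : val [tuple y i | i < n] =
    val [tuple tnth [tuple x i | i < n] (s i) | i < n] by [].
by have := congr1 (fun u : n.-tuple X => tnth u i) e;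
  rewrite !tnth_mktuple ffunE.
Qed.

(** H(z) is a single orbit.  Rather than computing stabilizers, sum [G] over all
    pairs of a relabeling and a vector of H(z): for a fixed vector the sum over
    relabelings does not depend on the vector, and for a fixed relabeling the
    sum over vectors does not depend on the relabeling. *)
Lemma mean_relabel (G : state -> R) x :
  (n`!)%:R^-1 * \sum_(s : 'S_n) G (relabel s x) =
  #|configs n_gt0 (mf x)|%:R^-1 * \sum_(y in configs n_gt0 (mf x)) G y.
Proof.
set H := configs n_gt0 (mf x).
have H0 : #|H|%:R != 0 :> R.
  by rewrite pnatr_eq0 -lt0n; apply/card_gt0P; exists x; rewrite inE.
have f0 : (n`!)%:R != 0 :> R by rewrite pnatr_eq0 -lt0n fact_gt0.
suff e : #|H|%:R * \sum_(s : 'S_n) G (relabel s x) =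
    n`!%:R * \sum_(y in H) G y.
  by apply: (mulfI H0); rewrite mulrCA e mulKf // mulVKf.
transitivity (\sum_(y in H) \sum_(s : 'S_n) G (relabel s y)).
  rewrite [LHS]mulr_natl -sumr_const; apply: eq_bigr => y.
  rewrite inE => /eqP/esym/mf_eq_relabel [u ->].
  rewrite [LHS](reindex_inj (@mulIg _ u)).
  by apply: eq_bigr => s _; rewrite relabelM.
rewrite exchange_big /= (eq_bigr (fun=> \sum_(y in H) G y)) => [|s _].
  by rewrite sumr_const card_Sn mulr_natl.
rewrite [RHS](reindex _ (onW_bij _ (relabel_bij s))).
by apply: eq_bigl => y; rewrite !inE mf_relabel.
Qed.

End Permutations.

Arguments relabel_bij {n X} s.

(** * The law of histories and states, and the dynamic program *)

Section PathExpectation.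
Variables (R : realType) (n : nat) (n_gt0 : (0 < n)%N) (T : nat).
Variables (X U : finType).
Local Notation state := {ffun 'I_n -> X}.
Local Notation prescription := {ffun X -> U}.
Local Notation M := (mean_field R n X).
Local Notation mf := (mean_field_of R n_gt0).

Variables (p0 : state -> R) (K : nat -> state -> prescription -> state -> R).

(** The expectation of [F] at the mean-field history and the state of time [t],
    when the state vector has initial law [p0] and transition kernel [K].  The
    recursion integrates the last transition out of [F], so that it passes
    through functions of ever shorter histories and never through a sum over
    histories, whose type is not finite. *)
Fixpoint path_exp (psi : strategy R n X U) t :
    (t.+1.-tuple M -> state -> R) -> R :=
  match t with
  | 0 => fun F => \sum_x p0 x * F [tuple mf x] x
  | s.+1 => fun F => path_exp psi (fun h x =>
      \sum_x' K s x (psi s h) x' * F [tuple of rcons h (mf x')] x')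
  end.

Hypothesis p0_ge0 : forall x, 0 <= p0 x.
Hypothesis K_ge0 : forall t x g x', 0 <= K t x g x'.

Lemma tnth_rcons_max t (h : t.+1.-tuple M) z :
  tnth [tuple of rcons h z] ord_max = z.
Proof. by rewrite (tnth_nth z) /= nth_rcons size_tuple ltnn eqxx. Qed.

(** The comparison is only needed where the last entry of the history is the
    mean-field of the state, as is the case along every path; this is how a
    Markovian strategy gets to see the current mean-field. *)
Lemma le_path_exp psi t (F G : t.+1.-tuple M -> state -> R) :
  (forall h x, tnth h ord_max = mf x -> F h x <= G h x) ->
  path_exp psi F <= path_exp psi G.
Proof.
elim: t F G => [|t IH] F G leFG /=.
  by apply: ler_sum => x _; rewrite ler_wpM2l // leFG // (tnth_nth (mf x)).
apply: IH => h x _; apply: ler_sum => x' _.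
by rewrite ler_wpM2l // leFG // tnth_rcons_max.
Qed.

Lemma eq_path_exp psi t (F G : t.+1.-tuple M -> state -> R) :
  (forall h x, tnth h ord_max = mf x -> F h x = G h x) ->
  path_exp psi F = path_exp psi G.
Proof.
by move=> eFG; apply: le_anti; rewrite !le_path_exp // => h x /eFG ->.
Qed.

Lemma path_expZ psi t c (F : t.+1.-tuple M -> state -> R) :
  path_exp psi (fun h x => c * F h x) = c * path_exp psi F.
Proof.
elim: t F => [|t IH] F /=.
  by rewrite mulr_sumr; apply: eq_bigr => x _; rewrite mulrCA.
rewrite -IH; apply: eq_path_exp => h x _.
by rewrite mulr_sumr; apply: eq_bigr => x' _; rewrite mulrCA.
Qed.

Lemma path_exp_sum psi t I (r : seq I) (F : I -> t.+1.-tuple M -> state -> R) :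
  path_exp psi (fun h x => \sum_(i <- r) F i h x) =
  \sum_(i <- r) path_exp psi (F i).
Proof.
elim: t F => [|t IH] F /=.
  by rewrite exchange_big; apply: eq_bigr => x _; rewrite mulr_sumr.
rewrite -IH; apply: eq_path_exp => h x _.
by rewrite exchange_big; apply: eq_bigr => x' _; rewrite mulr_sumr.
Qed.

Lemma path_expD psi t (F G : t.+1.-tuple M -> state -> R) :
  path_exp psi (fun h x => F h x + G h x) = path_exp psi F + path_exp psi G.
Proof.
have := path_exp_sum psi [:: true; false] (fun b => if b then F else G).
rewrite !big_cons big_nil addr0 => <-; apply: eq_path_exp => h x _.
by rewrite !big_cons big_nil addr0.
Qed.

Hypothesis p0_relabel : forall s x, p0 (relabel s x) = p0 x.
Hypothesis K_relabel : forall t s x g x', (t < T)%N ->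
  K t (relabel s x) g (relabel s x') = K t x g x'.

(** Exchangeability: a relabeling of the state of time [t] is pulled back through
    the kernel to a relabeling of the state of time [t - 1]; the prescription
    is the same on both sides, as it is a function of mean-fields. *)
Lemma path_exp_relabel psi t (F : t.+1.-tuple M -> state -> R) s :
  (t <= T)%N -> path_exp psi (fun h x => F h (relabel s x)) = path_exp psi F.
Proof.
elim: t F => [|t IH] F leT /=.
  rewrite [RHS](reindex _ (onW_bij _ (relabel_bij s))).
  by apply: eq_bigr => x _; rewrite p0_relabel mf_relabel.
rewrite -[RHS]IH 1?ltnW //; apply: eq_path_exp => h x _.
rewrite [RHS](reindex _ (onW_bij _ (relabel_bij s))).
by apply: eq_bigr => x' _; rewrite K_relabel // mf_relabel.
Qed.

(** This is the conditional uniformity of the state on H(z), in integrated form. *)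
Lemma path_exp_average psi t (F : t.+1.-tuple M -> state -> R) : (t <= T)%N ->
  path_exp psi F = path_exp psi (fun h x =>
    #|configs n_gt0 (mf x)|%:R^-1 * \sum_(y in configs n_gt0 (mf x)) F h y).
Proof.
move=> leT.
under [RHS]eq_path_exp do rewrite -(mean_relabel n_gt0 (F _)).
rewrite path_expZ path_exp_sum.
under eq_bigr do rewrite path_exp_relabel //.
by rewrite sumr_const card_Sn -[X in _ * X]mulr_natl mulKf.
Qed.

Variable ell : nat -> state -> {ffun 'I_n -> U} -> R.

Definition stage_exp psi t : R := path_exp psi (fun h x =>
  ell t x (apply_prescription (psi t h) x)).

(** The right-hand side of the dynamic program with both of its terms under one
    average over H(z), the form in which [path_exp_average] produces it. *)
Definition bellman t (v : M -> R) (z : M) (g : prescription) : R :=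
  #|configs n_gt0 z|%:R^-1 * \sum_(x in configs n_gt0 z)
    (ell t x (apply_prescription g x) + \sum_x' K t x g x' * v (mf x')).

(** Averaging over the states with the current mean-field leaves the history, and
    with it the prescription [psi t h], untouched. *)
Lemma stage_exp_bellman psi t (v : M -> R) : (t < T)%N ->
  stage_exp psi t + path_exp psi (fun _ : t.+2.-tuple M => v \o mf) =
  path_exp psi (fun h x => bellman t v (mf x) (psi t h)).
Proof.
by move=> ltT; rewrite /= -path_expD path_exp_average // ltnW.
Qed.

Variable V : nat -> M -> R.
Hypothesis V_end : forall z, V T z = 0.

Lemma stage_exp_advantage psi t : (t < T)%N ->
  stage_exp psi t =
  path_exp psi (fun h x => bellman t (V t.+1) (mf x) (psi t h) - V t (mf x)) -
  (path_exp psi (fun _ : t.+2.-tuple M => V t.+1 \o mf) -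
   path_exp psi (fun _ : t.+1.-tuple M => V t \o mf)).
Proof.
move=> ltT; rewrite path_expD -stage_exp_bellman //.
under [X in _ + X - _]eq_path_exp do rewrite -mulN1r.
by rewrite path_expZ mulN1r opprB addrA subrK addrK.
Qed.

(** The decomposition of the cost into the value at time 0 and the advantages.
    It holds for every [V] with the right end value: the terms in [V] telescope. *)
Lemma sum_stage_exp psi :
  \sum_(t < T) stage_exp psi t = \sum_x p0 x * V 0 (mf x) +
  \sum_(t < T) path_exp psi (fun h x =>
    bellman t (V t.+1) (mf x) (psi t h) - V t (mf x)).
Proof.
under eq_bigr do rewrite stage_exp_advantage //.
rewrite sumrB addrC; congr (_ + _).
rewrite -(big_mkord xpredT (fun t =>
  path_exp psi (fun _ : t.+2.-tuple M => V t.+1 \o mf) -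
  path_exp psi (fun _ : t.+1.-tuple M => V t \o mf))).
rewrite (telescope_sumr (fun t =>
  path_exp psi (fun _ : t.+1.-tuple M => V t \o mf))) //.
(* The zero function is written as a multiple, for [path_expZ]. *)
rewrite opprB addrC (@eq_path_exp _ _ _ (fun _ _ => 0 * 0)) => [|h x _].
  by rewrite path_expZ mul0r oppr0 add0r.
by rewrite /= V_end mul0r.
Qed.

Lemma le_sum_stage_exp psi :
  (forall t z g, (t < T)%N -> V t z <= bellman t (V t.+1) z g) ->
  \sum_x p0 x * V 0 (mf x) <= \sum_(t < T) stage_exp psi t.
Proof.
move=> leV; rewrite sum_stage_exp lerDl; apply: sumr_ge0 => t _.
rewrite -[leLHS](mul0r (path_exp psi (fun (_ : t.+1.-tuple M) _ => 0))).
rewrite -path_expZ.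
by apply: le_path_exp => h x _; rewrite mul0r subr_ge0 leV.
Qed.

Lemma sum_stage_exp_markov (g : markov_strategy R n X U) :
  (forall t z, (t < T)%N -> V t z = bellman t (V t.+1) z (g t z)) ->
  \sum_(t < T) stage_exp (of_markov g) t = \sum_x p0 x * V 0 (mf x).
Proof.
move=> eV; rewrite sum_stage_exp -[RHS]addr0; congr (_ + _); apply: big1 => t _.
rewrite (@eq_path_exp _ _ _ (fun _ _ => 0 * 0)) => [|h x hx].
  by rewrite path_expZ mul0r.
by rewrite /of_markov hx -eV // subrr mul0r.
Qed.

End PathExpectation.
(** * Discrete random variables *)

Section Discrete.
Context {d : measure_display} {Omega : measurableType d} {R : realType}.
Variable P : probability Omega R.

(** An arbitrary set is the countable disjoint union of its pieces [D k], of at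
    most one point each, on which the two laws agree. *)
Lemma has_pmf_law (E : countType) (Y Y' : Omega -> E) p (A : set E) :
  has_pmf P Y p -> has_pmf P Y' p -> P (Y @^-1` A) = P (Y' @^-1` A).
Proof.
move=> [mY pY] [mY' pY'].
pose D k := [set a | A a /\ pickle a = k].
have AD : A = \bigcup_k D k.
  by apply/seteqP; split=> [a Aa|a [k _] [] //]; exists (pickle a).
have law Z : has_pmf P Z p -> P (Z @^-1` A) =
    (\sum_(0 <= k <oo) P (Z @^-1` D k))%E.
  move=> [mZ _]; rewrite {1}AD preimage_bigcup measure_bigcup //.
  + apply: eq_eseriesl => k; by rewrite in_setT.
  + by move=> i j _ _ [w [/= [_ <-] [_ <-]]].
rewrite !law //; apply: eq_eseriesr => k _.
have [[a [Aa ka]]|none] := pselect (exists a, A a /\ pickle a = k).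
  have -> : D k = [set a].
    apply/seteqP; split=> [b [_ kb]|b ->] //.
    by apply: (pcan_inj pickleK); rewrite kb.
  by rewrite pY pY'.
have -> : D k = set0 by rewrite -subset0 => a Da; apply: none; exists a.
by rewrite !preimage_set0.
Qed.

(** Decomposition of an integral along finitely many events.  It serves to split
    off one step of the run, the events being those that fix the outcome of
    the step. *)
Lemma integral_sum_events (I : finType) (A : I -> set Omega)
    (phi : I -> Omega -> R) (psi : Omega -> R) :
  (forall e, measurable (A e)) ->
  (forall e, P.-integrable setT (EFin \o phi e)) ->
  (forall w, psi w = \sum_e phi e w * \1_(A e) w) ->
  P.-integrable setT (EFin \o psi) /\
  forall D, measurable D -> (\int[P]_(w in D) (psi w)%:E =
    \sum_e \int[P]_(w in D `&` A e) (phi e w)%:E)%E.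
Proof.
move=> mA iphi psiE.
have patchE e : ((fun w => (phi e w)%:E) \_ (A e) =
    fun w => (phi e w * \1_(A e) w)%:E)%E.
  by apply/funext => u; rewrite epatch_indic /= EFinM.
have iterm e : P.-integrable setT (fun w => (phi e w * \1_(A e) w)%:E).
  rewrite -patchE.
  apply/(integrable_mkcond _ (mA e)).
  exact: integrableS (iphi e).
have sumE : EFin \o psi = (fun w => \sum_e (phi e w * \1_(A e) w)%:E)%E.
  by apply/funext => w; rewrite /= psiE sumEFin.
split=> [|D mD]; first by rewrite sumE; exact: integrable_sum.
rewrite -[LHS]/(\int[P]_(w in D) ((EFin \o psi) w))%E sumE.
rewrite integral_sum// => [|e]; last exact: integrableS (iterm e).
by apply: eq_bigr => e _; rewrite integral_mkcondr patchE.
Qed.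

End Discrete.

(** * The law of the run *)

Section RunLaw.
Variables (R : realType) (n : nat) (n_gt0 : (0 < n)%N) (T : nat).
Variables (X U : finType) (W : nat -> countType).
Local Notation state := {ffun 'I_n -> X}.
Local Notation prescription := {ffun X -> U}.
Local Notation M := (mean_field R n X).
Local Notation mf := (mean_field_of R n_gt0).
Variable f : forall t, X -> U -> W t -> M -> X.
Context {d : measure_display} {Omega : measurableType d}.
Variable P : probability Omega R.
Variables (X1 : 'I_n -> Omega -> X) (N : forall t, 'I_n -> Omega -> W t).
Variables (PX : X -> R) (PW : forall t, W t -> R).
Hypothesis hX1 : forall i, has_pmf P (X1 i) PX.
Hypothesis hN : forall t, (t < T)%N -> forall i, has_pmf P (N t i) (@PW t).
Hypothesis hindep : mutually_independent P (primitive (T := T) X1 N).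

Definition init_law (x : state) : R := \prod_i PX (x i).

Definition transition_event t (x : state) (g : prescription) (x' : state) i :
  set (W t) := [set w | f (x i) (g (x i)) w (mf x) = x' i].

Definition transition_law t x g x' : R :=
  \prod_i fine (P (N t i @^-1` transition_event x g x' i)).

Lemma init_law_ge0 x : 0 <= init_law x.
Proof.
apply: prodr_ge0 => i _; rewrite -lee_fin.
by have [_ <-] := hX1 i; exact: measure_ge0.
Qed.

Lemma init_law_relabel s x : init_law (relabel s x) = init_law x.
Proof.
rewrite /init_law [RHS](reindex_inj (@perm_inj _ s)).
by apply: eq_bigr => i _; rewrite ffunE.
Qed.

Lemma transition_law_ge0 t x g x' : 0 <= transition_law t x g x'.
Proof. by apply: prodr_ge0 => i _; rewrite fine_ge0. Qed.

(** The noises of one stage have the same law, so a factor of the product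
    depends on its index only through the local states. *)
Lemma transition_law_relabel t s x g x' : (t < T)%N ->
  transition_law t (relabel s x) g (relabel s x') = transition_law t x g x'.
Proof.
move=> ltT; rewrite /transition_law [RHS](reindex_inj (@perm_inj _ s)).
apply: eq_bigr => i _; congr fine.
have -> : transition_event (t := t) (relabel s x) g (relabel s x') i =
          transition_event (t := t) x g x' (s i).
  by rewrite /transition_event mf_relabel !ffunE.
exact: has_pmf_law (hN ltT i) (hN ltT (s i)).
Qed.

Definition noise_from t (B : forall s, 'I_n -> set (W s)) : set Omega :=
  [set w | forall s, (t <= s < T)%N -> forall i, B s i (N s i w)].

Definition cylinder (A : 'I_n -> set X) (B : forall s, 'I_n -> set (W s))
    (j : primitive_index n T) : set (primitive_type X W j) :=
  match j with inl i => A i | inr (s, i) => B s i end.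

Lemma measurable_noise_from t B : measurable (noise_from t B).
Proof.
have -> : noise_from t B = \bigcap_(j in [set j : 'I_T * 'I_n | (t <= j.1)%N])
    (N j.1 j.2 @^-1` B j.1 j.2).
  apply/seteqP; split=> w h => [[s i] /= ts|s /andP[ts sT] i].
    by apply: h; rewrite ts ltn_ord.
  exact: (h (Ordinal sT, i)).
apply: fin_bigcap_measurable => [|[s i] _]; first exact: finite_finset.
by have [+ _] := hN (ltn_ord s) i; apply.
Qed.

(** Mutual independence applied to a rectangle in the noises of the stages from
    [t] on and, if [b] holds, in the initial states. *)
Lemma cylinder_prob (b : bool) t A B :
  P ([set w | b -> forall i, A i (X1 i w)] `&` noise_from t B) =
  (\prod_(i | b) P (X1 i @^-1` A i) *
   \prod_(s < T | (t <= s)%N) \prod_i P (N s i @^-1` B s i))%E.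
Proof.
pose J : {set primitive_index n T} :=
  [set j : 'I_n + 'I_T * 'I_n | if j is inr p then (t <= p.1)%N else b]%SET.
have := hindep J (cylinder A B); rewrite [RHS]big_sumType /=.
set L := P _; set L' := P _; have -> : L = L'.
  congr (P _); apply/seteqP; split=> w /=.
    move=> h; split=> [hb i|s /andP[ts sT] i].
      by apply: (h (inl i)); rewrite inE.
    by apply: (h (inr (Ordinal sT, i))); rewrite inE.
  move=> [hA hB] [i|[s i]]; rewrite inE => hj; first exact: hA.
  by apply: hB; rewrite hj ltn_ord.
move=> ->; congr (_ * _)%E; first by apply: eq_bigl => i; rewrite inE.
rewrite pair_big_dep /=.
by apply: eq_big => [[s i]|[s i] _] //; rewrite inE andbT.
Qed.

Lemma noise_from_prob t B : P (noise_from t B) =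
  (\prod_(s < T | (t <= s)%N) \prod_i P (N s i @^-1` B s i))%E.
Proof.
have := cylinder_prob false t (fun=> setT) B.
rewrite big_pred0 // mul1e => <-; congr (P _).
by apply/seteqP; split=> [w h|w []].
Qed.

Lemma noise_from_step t B : (t < T)%N ->
  fine (P (noise_from t B)) =
  \prod_i fine (P (N t i @^-1` B t i)) * fine (P (noise_from t.+1 B)).
Proof.
move=> ltT; apply: EFin_inj; rewrite EFinM -prodEFin.
rewrite fineK ?fin_num_measure //; last exact: measurable_noise_from.
rewrite fineK ?fin_num_measure //; last exact: measurable_noise_from.
rewrite !noise_from_prob (bigD1 (Ordinal ltT)) //=; congr (_ * _)%E.
  apply: eq_bigr => i _; rewrite fineK ?fin_num_measure //.
  by have [+ _] := hN ltT i; apply.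
by apply: eq_bigl => s; rewrite ltn_neqAle andbC eq_sym.
Qed.

Lemma noise_from_init (x : state) B :
  P ([set w | forall i, X1 i w = x i] `&` noise_from 0 B) =
  ((init_law x)%:E * P (noise_from 0 B))%E.
Proof.
have -> : [set w | forall i, X1 i w = x i] =
          [set w | true -> forall i, [set x i] (X1 i w)].
  by apply/seteqP; split=> w h => [_ i|i]; [exact: (h i)|exact: (h isT i)].
rewrite (cylinder_prob true 0 (fun i => [set x i]) B) -noise_from_prob.
rewrite /init_law -prodEFin; congr (_ * _)%E; apply: eq_bigr => i _.
by have [_ ->] := hX1 i.
Qed.

(** The rectangle of the noises from stage [t] on that carry [x] to [x'] at
    stage [t] and lie in [B] afterwards. *)
Definition transition_noise t x g x' (B : forall s, 'I_n -> set (W s)) s i :=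
  if s == t then transition_event (t := s) x g x' i else B s i.

Lemma noise_from_transition t x g x' B : (t < T)%N ->
  noise_from t.+1 B `&` [set w | forall i, transition_event x g x' i (N t i w)]
  = noise_from t (transition_noise t x g x' B).
Proof.
move=> ltT; apply/seteqP; split=> w.
  move=> [hB hA] s /andP[ts sT] i; rewrite /transition_noise.
  case: eqP hA => [->|/eqP st] hA; first exact: hA.
  by apply: hB; rewrite sT ltn_neqAle eq_sym st ts.
move=> h; split=> [s /andP[ts sT] i|i].
  have := h s; rewrite (ltnW ts) sT => /(_ isT i).
  by rewrite /transition_noise gtn_eqF.
by have := h t; rewrite leqnn ltT => /(_ isT i); rewrite /transition_noise eqxx.
Qed.

Lemma prob_transition t x g x' B : (t < T)%N ->
  fine (P (noise_from t (transition_noise t x g x' B))) =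
  transition_law t x g x' * fine (P (noise_from t.+1 B)).
Proof.
move=> ltT; rewrite noise_from_step //; congr (_ * _).
  by apply: eq_bigr => i _; rewrite /transition_noise eqxx.
congr (fine (P _)); apply/seteqP; split=> w h s /andP[ts sT] i;
  by have := h s; rewrite ts sT => /(_ isT i);
    rewrite /transition_noise gtn_eqF.
Qed.

Lemma measurable_transition t x g x' : (t < T)%N ->
  measurable [set w | forall i, transition_event x g x' i (N t i w)].
Proof.
move=> ltT; rewrite [X in measurable X](_ : _ =
  \bigcap_(i in setT) (N t i @^-1` transition_event x g x' i)).
  apply: fin_bigcap_measurable => [|i _]; first exact: finite_finset.
  by have [+ _] := hN ltT i; apply.
by apply/seteqP; split=> w h i => [_|]; apply: h.
Qed.

Lemma indic_transition t x g x' w :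
  \1_[set w | forall i, transition_event x g x' i (N t i w)] w =
  (x' == next_state f x g (fun i => N t i w) (mf x))%:R :> R.
Proof.
rewrite indicE; congr (_%:R); congr (nat_of_bool _).
apply/idP/eqP => [|->].
  by rewrite inE => h; apply/ffunP => i; rewrite ffunE h.
by rewrite inE => i; rewrite /transition_event/= ffunE.
Qed.

Lemma fine_measureK (A : set Omega) : measurable A -> P A = (fine (P A))%:E.
Proof. by move=> mA; rewrite fineK // fin_num_measure. Qed.

(** The rectangle [B] in the noises that are still to come makes the induction
    work: a step adds to it the noises of stage [t], and the induction
    hypothesis is applied to the enlarged rectangle.  So the independence of
    the past and the current noises enters only through the product formula
    for rectangles. *)
Lemma integral_run psi t (F : t.+1.-tuple M -> state -> R) : (t <= T)%N ->
  let FR w := F (run n_gt0 f X1 N psi w t).1 (run n_gt0 f X1 N psi w t).2 in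
  P.-integrable setT (EFin \o FR) /\
  forall B, (\int[P]_(w in noise_from t B) (FR w)%:E)%E =
    (path_exp n_gt0 init_law transition_law psi F *
     fine (P (noise_from t B)))%:E.
Proof.
elim: t F => [|t IH] F leT FR.
  have mX x : measurable [set w | forall i, X1 i w = x i].
    rewrite [X in measurable X](_ : _ =
      \bigcap_(i in setT) (X1 i @^-1` [set x i])).
      apply: fin_bigcap_measurable => // i _.
      by have [+ _] := hX1 i; apply.
    by apply/seteqP; split=> w h i => [_|]; apply: h.
  have [||iF intF] := @integral_sum_events _ _ _ P state
    (fun x => [set w | forall i, X1 i w = x i])
    (fun x => cst (F [tuple mf x] x)) FR mX.
  - by move=> x; exact: finite_measure_integrable_cst.
  - move=> w; pose x0 : state := [ffun i => X1 i w].
    rewrite (bigD1 x0) //= big1 => [|x xx0].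
      rewrite indicE mem_set ?mulr1 ?addr0 // => i; by rewrite ffunE.
    rewrite indicE memNset ?mulr0 // => h; move/eqP: xx0; apply.
    by apply/ffunP => i; rewrite ffunE h.
  split=> // B; rewrite intF; last exact: measurable_noise_from.
  rewrite /= mulr_suml -sumEFin; apply: eq_bigr => x _.
  rewrite integral_cst; last first.
    by apply: measurableI => //; exact: measurable_noise_from.
  rewrite setIC [X in (_ * X)%E](noise_from_init x B).
  rewrite [P _]fine_measureK; last exact: measurable_noise_from.
  by rewrite -!EFinM mulrA [F _ _ * _]mulrC.
(* A step is resolved into its source, prescription and target; given these
   three, it is an event in the noises of stage [t] alone. *)
pose Fe (e : state * prescription * state) (h : t.+1.-tuple M) x0 :=
  ((x0 == e.1.1) && (psi t h == e.1.2))%:R * F [tuple of rcons h (mf e.2)] e.2.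
pose E (e : state * prescription * state) : set Omega :=
  [set w | forall i, transition_event e.1.1 e.1.2 e.2 i (N t i w)].
have [||| iF intF] := @integral_sum_events _ _ _ P
  (state * prescription * state)%type E
  (fun e w => Fe e (run n_gt0 f X1 N psi w t).1 (run n_gt0 f X1 N psi w t).2)
  FR.
- by move=> e; exact: measurable_transition.
- by move=> e; have [] := IH (Fe e) (ltnW leT).
- move=> w; rewrite /FR /=; case: (run n_gt0 f X1 N psi w t) => h x /=.
  set x' := next_state _ _ _ _ _.
  rewrite (bigD1 (x, psi t h, x')) //= big1 => [|[[y g] y'] ne].
    by rewrite addr0 indic_transition /Fe /= !eqxx !mul1r mulr1.
  rewrite indic_transition /Fe /=.
  case: (x =P y) ne => [<-|_ _]; last by rewrite !mul0r.
  case: (psi t h =P g) => [<-|_ _]; last by rewrite !mul0r.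
  by rewrite -/x' xpair_eqE eqxx /= => /negPf ->; rewrite mulr0.
split=> // B; rewrite intF; last exact: measurable_noise_from.
transitivity (\sum_(e : state * prescription * state)
    (path_exp n_gt0 init_law transition_law psi (Fe e) *
    transition_law t e.1.1 e.1.2 e.2 *
    fine (P (noise_from t.+1 B)))%:E)%E.
  apply: eq_bigr => [[[x g] x'] _].
  rewrite noise_from_transition //.
  have [_ ->] := IH (Fe (x, g, x')) (ltnW leT).
  by rewrite prob_transition // mulrA.
rewrite sumEFin -mulr_suml; congr (_ * _)%:E => /=.
under eq_bigr do rewrite mulrC -(path_expZ _ init_law_ge0 transition_law_ge0).
rewrite -(path_exp_sum _ init_law_ge0 transition_law_ge0).
apply: (eq_path_exp init_law_ge0 transition_law_ge0) => h x _.
rewrite -(pair_bigA _ (fun (y : state * prescription) x' =>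
  transition_law t y.1 y.2 x' * Fe (y, x') h x)) /=.
rewrite (bigD1 (x, psi t h)) //= [X in _ + X]big1 => [|[y g] ne].
  by rewrite addr0; apply: eq_bigr => x' _; rewrite /Fe /= !eqxx mul1r.
rewrite big1 // => x' _; rewrite /Fe /=.
case: (x =P y) => [xy|]; last by rewrite mul0r mulr0.
case: (psi t h =P g) => [hg|]; last by rewrite mul0r mulr0.
by move: ne; rewrite -hg -xy eqxx.
Qed.

Lemma integral_run_stage psi t (F : t.+1.-tuple M -> state -> R) : (t <= T)%N ->
  (\int[P]_w (F (run n_gt0 f X1 N psi w t).1
               (run n_gt0 f X1 N psi w t).2)%:E)%E =
  (path_exp n_gt0 init_law transition_law psi F)%:E.
Proof.
move=> leT; have [_ /(_ (fun _ _ => setT))] := integral_run psi F leT.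
have -> : noise_from t (fun _ _ => setT) = setT by apply/seteqP; split.
by move=> ->; rewrite probability_setT mulr1.
Qed.

Lemma expectation_next_state t x g (v : state -> R) : (t < T)%N ->
  'E_P[fun w => v (next_state f x g (fun i => N t i w) (mf x))]%E =
  (\sum_x' transition_law t x g x' * v x')%:E.
Proof.
move=> ltT; rewrite unlock.
have [||| _ intE] := @integral_sum_events _ _ _ P state
  (fun x' => [set w | forall i, transition_event x g x' i (N t i w)])
  (fun x' => cst (v x'))
  (fun w => v (next_state f x g (fun i => N t i w) (mf x))).
- by move=> x'; exact: measurable_transition.
- by move=> x'; exact: finite_measure_integrable_cst.
- move=> w; rewrite (bigD1 (next_state f x g (fun i => N t i w) (mf x))) //=.
  rewrite indic_transition eqxx mulr1 big1 ?addr0 // => x' /negPf ne.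
  by rewrite indic_transition ne mulr0.
rewrite intE; last exact: measurableT.
rewrite -sumEFin; apply: eq_bigr => x' _.
have sT : noise_from t.+1 (fun _ _ => setT) = setT by apply/seteqP; split.
have := @noise_from_transition t x g x' (fun _ _ => setT) ltT; rewrite sT => ->.
rewrite /= integral_cst; last exact: measurable_noise_from.
rewrite [X in (_ * X)%E]fine_measureK; last exact: measurable_noise_from.
by rewrite prob_transition // sT probability_setT mulr1 -EFinM mulrC.
Qed.

End RunLaw.
(** * Optimality *)

Section BellmanMinimum.
Variables (R : realType) (n : nat) (n_gt0 : (0 < n)%N) (X U : finType).
Variables (W : nat -> countType).
Variable f : forall t : nat, X -> U -> W t -> mean_field R n X -> X.
Variable ell : nat -> {ffun 'I_n -> X} -> {ffun 'I_n -> U} -> R.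
Context {d : measure_display} {Omega : measurableType d}.
Variable P : probability Omega R.
Variables (N : forall t : nat, 'I_n -> Omega -> W t) (u0 : U).

Lemma dp_min_le t v z g :
  dp_min n_gt0 f ell P N u0 t v z <= dp_rhs n_gt0 f ell P N t v z g.
Proof. exact: bigmin_le. Qed.

Lemma dp_min_attained t v z :
  exists g, dp_rhs n_gt0 f ell P N t v z g = dp_min n_gt0 f ell P N u0 t v z.
Proof.
pose rhs := dp_rhs n_gt0 f ell P N t v z.
have [g _ gP] := @arg_minP _ _ _ ([ffun=> u0] : {ffun X -> U}) xpredT rhs isT.
exists g; apply: le_anti; rewrite dp_min_le andbT.
by apply: le_bigmin => [|h _]; apply: gP.
Qed.

End BellmanMinimum.

Theorem theorem1 (R : realType) (n T : nat) (n_gt0 : (0 < n)%N)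
  (X U : finType) (u0 : U) (W : nat -> countType)
  (f : forall t : nat, X -> U -> W t -> mean_field R n X -> X)
  (ell : nat -> {ffun 'I_n -> X} -> {ffun 'I_n -> U} -> R)
  (d : measure_display) (Omega : measurableType d) (P : probability Omega R)
  (X1 : 'I_n -> Omega -> X) (N : forall t : nat, 'I_n -> Omega -> W t)
  (PX : X -> R) (PW : forall t : nat, W t -> R)
  (hX1 : forall i : 'I_n, has_pmf P (X1 i) PX)
  (hN : forall t : nat, (t < T)%N ->
     forall i : 'I_n, has_pmf P (N t i) (PW t))
  (hindep : mutually_independent P (primitive (T := T) X1 N)) :
  let J := total_cost n_gt0 T f ell P X1 N in
  ereal_inf [set J psi | psi in [set: strategy R n X U]] =
  ereal_inf [set J (of_markov g) | g in [set: markov_strategy R n X U]] /\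
  (forall g : markov_strategy R n X U,
     dp_minimizer n_gt0 T f ell P N u0 g ->
     forall psi : strategy R n X U, (J (of_markov g) <= J psi)%E).
Proof.
move=> J; pose p0 := init_law (n := n) PX; pose K := transition_law n_gt0 f P N.
have p0_ge0 := init_law_ge0 hX1; have K_ge0 := transition_law_ge0 n_gt0 f P N.
have K_sym : forall t s x g x', (t < T)%N ->
    K t (relabel s x) g (relabel s x') = K t x g x'.
  by move=> t s x g x' ltT; exact: (transition_law_relabel n_gt0 f hN).
have p0_sym := @init_law_relabel R n X PX.
pose V := value n_gt0 T f ell P N u0.
have JE psi : J psi = (\sum_(t < T) stage_exp n_gt0 p0 K ell psi t)%:E.
  rewrite /J /total_cost unlock -sumEFin.
  pose F t (h : t.+1.-tuple (mean_field R n X)) x :=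
    ell t x (apply_prescription (psi t h) x).
  have costE t w : stage_cost n_gt0 f ell X1 N psi t w =
      F t (run n_gt0 f X1 N psi w t).1 (run n_gt0 f X1 N psi w t).2.
    by rewrite /stage_cost; case: run.
  under eq_integral do rewrite -sumEFin.
  rewrite integral_sum //= => [|t].
    apply: eq_bigr => t _.
    rewrite -(integral_run_stage n_gt0 f hX1 hN hindep) 1?ltnW //.
    by apply: eq_integral => w _; rewrite costE.
  have [+ _] := integral_run n_gt0 f hX1 hN hindep psi (F t) (ltnW (ltn_ord t)).
  by congr (integrable _ _); apply/funext => w; rewrite /= costE.
have dpE t v z g : (t < T)%N ->
    dp_rhs n_gt0 f ell P N t v z g = bellman n_gt0 K ell t v z g.
  move=> ltT; rewrite /dp_rhs /cost_hat /cond_exp_next /bellman -mulrDr.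
  rewrite -big_split.
  congr (_ * _); apply: eq_bigr => x; rewrite inE => /eqP <-.
  by rewrite (expectation_next_state n_gt0 f hN hindep x g
    (v \o mean_field_of R n_gt0) ltT).
have V_end z : V T z = 0 by exact: value_end.
have leJ psi : ((\sum_x p0 x * V 0 (mean_field_of R n_gt0 x))%:E <= J psi)%E.
  rewrite JE lee_fin.
  apply: (le_sum_stage_exp p0_ge0 K_ge0 p0_sym K_sym) => // t z g ltT.
  by rewrite -dpE // /V value_step // dp_min_le.
have minJ g : dp_minimizer n_gt0 T f ell P N u0 g ->
    J (of_markov g) = (\sum_x p0 x * V 0 (mean_field_of R n_gt0 x))%:E.
  move=> gmin; rewrite JE; congr (_%:E).
  apply: (sum_stage_exp_markov p0_ge0 K_ge0 p0_sym K_sym) => // t z ltT.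
  rewrite -dpE // /V value_step //; apply: le_anti; rewrite dp_min_le /=.
  by have [h <-] := dp_min_attained n_gt0 f ell P N u0 t (V t.+1) z;
    exact: gmin.
split=> [|g /minJ -> psi]; last exact: leJ.
(* Minimizers exist, since there are finitely many prescriptions; hence both
   infima are the lower bound. *)
have att t z := dp_min_attained n_gt0 f ell P N u0 t (V t.+1) z.
pose g t z := projT1 (cid (att t z)).
have gmin : dp_minimizer n_gt0 T f ell P N u0 g.
  by move=> t _ z h; rewrite /g; case: cid => k /= ->; exact: dp_min_le.
apply: le_anti; apply/andP; split.
  by apply: le_ereal_inf => _ [h _ <-]; exists (of_markov h).
apply: le_ereal_inf_tmp => _ [psi _ <-]; apply: le_trans (leJ psi).
by rewrite -(minJ _ gmin); apply: ereal_inf_lbound; exists g.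
Qed.
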